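(* Let $X$ be a finite-dimensional real normed space, $K\subset X$ a nonempty closed convex set, and $f:K\times K\to\mathbb{R}$ a bifunction with $f\in\mathcal{SQ}(K)$. Suppose that $f_q(\cdot,y):K\to\mathbb{R}$ is upper semicontinuous for all $y\in K$, that $f_q(x,x)=0$ for all $x\in K$, and that $f_q$ satisfies the coercivity condition (C2). Then $\operatorname{EP}(f,K)$ is nonempty.
   Context: For $h:X\to[-\infty,+\infty]$ and $\lambda\in\mathbb{R}$ let $S_\lambda(h)=\{x\in X:h(x)\le\lambda\}$. The quasiconvex regularization of $h$ is $h_q(x)=\inf\{\lambda\in\mathbb{R}:x\in\mathrm{co}(S_\lambda(h))\}$ (with $\inf\emptyset=+\infty$), where $\mathrm{co}$ is the convex hull. For $f:K\times K\to\mathbb{R}$ and $x\in K$, extend $f(x,\cdot)$ to $X$ by $+\infty$ outside $K$ and put $f_q(x,\cdot)=(f(x,\cdot))_q$, regarded as a function on $K$. $\mathcal{Q}(K)$ is the family of bifunctions $f:K\times K\to\mathbb{R}$ such that $f_q(x,y)\in\mathbb{R}$ for all $x,y\in K$. A function $h:K\to\mathbb{R}$ is quasiconvex if $h(tx+(1-t)y)\le\max\{h(x),h(y)\}$ for all $x,y\in K$, $t\in[0,1]$; it is semistrictly quasiconvex if it is quasiconvex and, for all $x,y\in K$, $h(x)<h(y)$ implies $h(tx+(1-t)y)<h(y)$ for all $t\in\,]0,1[$. $\mathcal{SQ}(K)$ is the family of $f\in\mathcal{Q}(K)$ such that $f_q(x,\cdot)$ is semistrictly quasiconvex on $K$ for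 all $x\in K$. A bifunction $g:K\times K\to\mathbb{R}$ satisfies the coercivity condition (C2) if for every sequence $\{x_n\}\subset K\setminus\{0\}$ with $\lim_{n\to+\infty}\|x_n\|=\infty$ there exist $n_0\in\mathbb{N}$ and $u_{n_0}\in K$ such that $\|u_{n_0}\|<\|x_{n_0}\|$ and $g(x_{n_0},u_{n_0})\le0$. $\operatorname{EP}(f,K)=\{x\in K:f(x,y)\ge0\text{ for all }y\in K\}$. *)

(* Defs.v *)
From HB Require Import structures.
From mathcomp Require Import all_boot all_order all_algebra.
From mathcomp Require Import all_classical all_reals all_analysis.

Set Implicit Arguments.
Unset Strict Implicit.
Unset Printing Implicit Defensive.

Import Order.TTheory GRing.Theory Num.Theory.
Import numFieldNormedType.Exports.

Local Open Scope classical_set_scope.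
Local Open Scope ring_scope.

Definition convex_hull (R : numDomainType) (X : lmodType R) (A : set X) : set X :=
  smallest (@convex_set R X) A.

Definition sublevel (R : realType) (X : Type) (h : X -> \bar R) (l : R) : set X :=
  [set x | (h x <= l%:E)%E].

(* [ereal_inf set0 = +oo], as the convention inf(emptyset) = +oo requires. *)
Definition qconvex_reg (R : realType) (X : lmodType R) (h : X -> \bar R) (x : X) :
    \bar R :=
  ereal_inf [set l%:E | l in [set l : R | convex_hull (sublevel h l) x]].

(* A bifunction on K x K is represented by a total [f : X -> X -> R], and a
   function on K by a total function on X. Everything below evaluates them at
   points of K only; the values elsewhere are irrelevant. *)

Definition extend_infty (R : realType) (X : Type) (K : set X) (h : X -> R) :
    X -> \bar R :=
  patch (fun=> +oo%E) K (EFin \o h).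

Definition fq_ereal (R : realType) (X : lmodType R) (K : set X)
    (f : X -> X -> R) (x : X) : X -> \bar R :=
  qconvex_reg (extend_infty K (f x)).

Definition classQ (R : realType) (X : lmodType R) (K : set X) :
    set (X -> X -> R) :=
  [set f | forall x y, K x -> K y -> fq_ereal K f x y \is a fin_num].

(* The real-valued f_q; it agrees with [fq_ereal] on K x K when f is in Q(K). *)
Definition fq (R : realType) (X : lmodType R) (K : set X)
    (f : X -> X -> R) (x y : X) : R :=
  fine (fq_ereal K f x y).

Definition quasiconvex (R : realType) (X : lmodType R) (K : set X) (h : X -> R) :=
  forall x y (t : R), K x -> K y -> 0 <= t <= 1 ->
    h (t *: x + (1 - t) *: y) <= Num.max (h x) (h y).

Definition semistrictly_quasiconvex (R : realType) (X : lmodType R) (K : set X)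
    (h : X -> R) :=
  quasiconvex K h /\
  forall x y, K x -> K y -> h x < h y ->
    forall t : R, 0 < t < 1 -> h (t *: x + (1 - t) *: y) < h y.

Definition classSQ (R : realType) (X : lmodType R) (K : set X) :
    set (X -> X -> R) :=
  [set f | classQ K f /\
           forall x, K x -> semistrictly_quasiconvex K (fq K f x)].

(* Upper semicontinuity with respect to the topology induced on K. *)
Definition upper_semicontinuous_on (R : realType) (X : topologicalType)
    (K : set X) (h : X -> R) :=
  forall x, K x -> forall a : R, h x < a ->
    \forall y \near within K (nbhs x), h y < a.

Definition coercive_C2 (R : realType) (X : normedModType R) (K : set X)
    (g : X -> X -> R) :=
  forall x_ : nat -> X,
    (forall n, K (x_ n) /\ x_ n != 0) ->
    `|x_ n| @[n --> \oo] --> +oo ->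
    exists n0 : nat, exists u : X,
      [/\ K u, `|u| < `|x_ n0| & g (x_ n0) u <= 0].

Definition EP (R : realType) (X : Type) (f : X -> X -> R) (K : set X) : set X :=
  [set x | K x /\ forall y, K y -> 0 <= f x y].

(* Main.v *)
From HB Require Import structures.
Require Import Defs.
From mathcomp Require Import all_boot all_order all_algebra.
From mathcomp Require Import zify.

(** Since [f_q <= f], an equilibrium of the regularization [f_q] is one of [f], so
    one works with [g = f_q], which is semistrictly quasiconvex in its second
    argument, upper semicontinuous in the first, and zero on the diagonal.

    On the compact convex set [K] intersected with a ball, Ky Fan's inequality
    ([ky_fan]) gives [x] with [g x y >= 0] for all [y] of that set; compactness
    comes from the finite dimension ([closed_bounded_compact]). Take such
    solutions [x_ n] for balls whose radii tend to infinity. If some [x_ n] is in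
    the interior of its ball, semistrict quasiconvexity of [g (x_ n)] propagates
    the inequality from the ball to all of [K] ([local_equilibrium_global], with
    [u = x_ n]). Otherwise the norms of the [x_ n] tend to infinity, the coercivity
    condition provides an interior point [u] with [g (x_ n) u <= 0] for some [n],
    and the same lemma applies to that [u].

    Ky Fan's inequality is as strong as Brouwer's fixed point theorem, which is
    reached here without triangulations. Scarf's lemma ([scarf]) is a parity
    argument about finite sets with several linear orders. Applied to the grid
    points of a simplex, ordered by each coordinate, it plays the role of Sperner's
    lemma ([sperner_grid]). A limit over finer and finer grids gives the dual form
    of the Knaster-Kuratowski-Mazurkiewicz lemma ([kkm_dual]); the usual form
    ([kkm]) follows by means of distance functions, and gives Ky Fan's inequality
    in its finite form, whence the general one by compactness. *)

Set Implicit Arguments.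
Unset Strict Implicit.
Unset Printing Implicit Defensive.

(** * Scarf's lemma *)

Lemma even_card_paired (T : finType) (P : {set T}) :
  (forall p, p \in P -> exists2 q, q \in P & q != p /\
     forall q', q' \in P -> q' = p \/ q' = q) ->
  ~~ odd #|P|.
Proof.
move=> paired; have [->|[p pP]] := set_0Vmem P; first by rewrite cards0.
have [q qP [neq_qp only_pq]] := paired p pP.
have -> : P = [set p; q].
  apply/setP => z; rewrite !inE; apply/idP/orP.
    by case/only_pq => ->; rewrite eqxx; [left|right].
  by case=> /eqP ->.
by rewrite cards2 eq_sym neq_qp.
Qed.

Lemma even_card_fibres (T Z : finType) (h : T -> Z) (P : {set T}) :
  (forall z, ~~ odd #|[set p in P | h p == z]|) -> ~~ odd #|P|.
Proof.
move=> even_fib; rewrite -sum1_card (partition_big h predT) //=.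
apply: (big_ind (fun m => ~~ odd m)) => // [m1 m2 /negbTE m1e /negbTE m2e|z _].
  by rewrite oddD m1e m2e.
by rewrite (eq_bigl (mem [set p in P | h p == z])) ?sum1_card // => p; rewrite !inE.
Qed.

(** The points of [U] are compared by one strict linear order per index, given by
    the injective ranks [r i], and carry the labels [c]. Besides the genuine
    points, [U] contains one [slack i] for each index, which stands for the facet
    of the simplex opposite to the vertex [i]: it lies below everything in its own
    order, above all genuine points in the other orders, and has label [i]. *)

Section Scarf.
Variables (U I : finType) (r : I -> U -> nat) (slack : I -> U) (c : U -> I).

(** Geometrically, the simplex cut out by the inequalities
    [r i y > min r i over A], for all [i], is empty. The primitive sets with
    [#|I|] elements play the role of the cells of a triangulation. *)
Definition primitive (A : {set U}) :=
  [forall y, exists i, [forall a in A, r i y <= r i a]].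

Lemma primitiveP (A : {set U}) :
  reflect (forall y, exists i, forall a, a \in A -> r i y <= r i a) (primitive A).
Proof.
apply: (iffP forallP) => [prA y|prA y].
  have /existsP[i /forallP ri] := prA y; exists i => a aA.
  by have := ri a; rewrite aA.
have [i ri] := prA y; apply/existsP; exists i.
by apply/forallP => a; apply/implyP => aA; apply: ri.
Qed.

Lemma primitiveS (A B : {set U}) : B \subset A -> primitive A -> primitive B.
Proof.
move=> /subsetP sBA /primitiveP prA; apply/primitiveP => y.
by have [i ri] := prA y; exists i => a aB; apply/ri/sBA.
Qed.

(** Moving the [k]-th face of the simplex cut out by [A] outwards, the points that
    it can meet are those that exceed a point of [A] in every other order. *)
Definition extends (A : {set U}) (k : I) (x : U) :=
  [forall (l | l != k), [exists a in A, r l a < r l x]].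

Lemma extendsP (A : {set U}) (k : I) (x : U) :
  reflect (forall l, l != k -> exists2 a, a \in A & r l a < r l x) (extends A k x).
Proof. by apply: (iffP forall_inP) => e l /e /exists_inP. Qed.

Hypothesis r_inj : forall i, injective (r i).
Hypothesis slack_min : forall i u, u != slack i -> r i (slack i) < r i u.
Hypothesis slack_top : forall i j t, (forall k, t != slack k) ->
  j != i -> r j t < r j (slack i).
Hypothesis c_slack : forall i, c (slack i) = i.

(** Of two points that a moving face can meet, the one met first lies inside the
    simplex of the other one, unless they agree. *)
Lemma extends_uniq (B : {set U}) k x y :
  extends B k x -> extends B k y ->
  primitive (x |: B) -> primitive (y |: B) -> x = y.
Proof.
wlog: x y / r k x <= r k y.
  move=> wl xk yk px py; case/orP: (leq_total (r k x) (r k y)) => le; first exact: wl.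
  by apply/esym/wl.
move=> le_xy xk /extendsP yk /primitiveP prx pry; apply: (@r_inj k); apply/eqP.
rewrite eqn_leq le_xy /=; have [i ri] := prx y.
have [<-|neq] := eqVneq i k; first by apply: ri; rewrite setU11.
have [a aB ay] := yk i neq.
by have := ri a (setU1r _ aB); rewrite leqNgt ay.
Qed.

(** In a primitive set each element is the least one for some order, since it is
    itself not in the interior of the simplex. When there are as many elements as
    orders, the map [m] from orders to least elements is thus a bijection. *)
Lemma primitive_minima (B : {set U}) x : x \notin B -> #|B|.+1 = #|I| ->
  primitive (x |: B) -> exists m : I -> U, exists k, [/\ injective m, m k = x,
    forall l, l != k -> m l \in B, forall a, a \in B -> exists l, m l = a &
    forall l a, a \in x |: B -> r l (m l) <= r l a].
Proof.
move=> xB cardB /primitiveP pr.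
pose m l := [arg min_(a < x in x |: B) r l a].
have mP l : m l \in x |: B /\ forall a, a \in x |: B -> r l (m l) <= r l a.
  by rewrite /m; case: arg_minnP => [|a aA amin]; [rewrite setU11|split].
have m_surj a : a \in x |: B -> exists l, m l = a.
  move=> aA; have [l rl] := pr a; exists l; apply: (@r_inj l); apply/eqP.
  by rewrite eqn_leq (mP l).2 // rl ?(mP l).1.
have imm : m @: [set: I] = x |: B.
  apply/setP => a; apply/imsetP/idP => [[l _ ->]|/m_surj[l <-]]; first exact: (mP l).1.
  by exists l.
have m_inj : injective m.
  have: {in [set: I] &, injective m}.
    by apply/imset_injP; rewrite imm cardsU1 xB cardsT -cardB.
  by move=> inj l1 l2; apply: inj; rewrite inE.
have [k mk] := m_surj x (setU11 _ _).
exists m, k; split=> // [l nlk|a aB|l a]; last exact: (mP l).2.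
  2: by apply: m_surj; rewrite setU1r.
have := (mP l).1; rewrite !inE => /orP[/eqP mlx|//].
by case/eqP: nlk; apply: m_inj; rewrite mk.
Qed.

(** A facet is shared by exactly two cells, unless it lies on the boundary, where
    all its elements are slack. Removing [x], which was least in the order [k], its
    role in that order is taken over by [b0], already least in one other order [j].
    A cell containing [B] is completed from the side [k] or from the side [j]:
    the side [k] leads back to [x], the side [j] to a new point [x']. *)
Lemma primitive_exchange (B : {set U}) x b : x \notin B -> #|B|.+1 = #|I| ->
  primitive (x |: B) -> b \in B -> (forall i, b != slack i) ->
  exists x', [/\ x' \notin B, x' != x, primitive (x' |: B) &
    forall y, y \notin B -> primitive (y |: B) -> y = x \/ y = x'].
Proof.
move=> xB cardB prA bB b_ns.
have prB : primitive B by apply: primitiveS prA; apply: subsetUr.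
have [m [k [m_inj mk mB m_surj m_min]]] := primitive_minima xB cardB prA.
pose b0 := [arg min_(a < b in B) r k a].
have [b0B b0_min] : b0 \in B /\ forall a, a \in B -> r k b0 <= r k a.
  by rewrite /b0; case: arg_minnP.
have minB_uniq l u v : u \in B -> v \in B -> (forall a, a \in B -> r l u <= r l a) ->
    (forall a, a \in B -> r l v <= r l a) -> u = v.
  by move=> uB vB ul vl; apply: (@r_inj l); apply/eqP; rewrite eqn_leq ul // vl.
have ext m' k' x1 : x1 \notin B -> injective m' -> m' k' = x1 ->
    (forall l, l != k' -> m' l \in B) ->
    (forall l a, a \in x1 |: B -> r l (m' l) <= r l a) -> extends B k' x1.
  move=> x1B inj' mk' mB' m_min'; apply/extendsP => l nl; exists (m' l); first exact: mB'.
  rewrite ltn_neqAle m_min' ?setU11 // andbT; apply: contra x1B => /eqP /r_inj <-.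
  exact: mB'.
have ext_k : extends B k x by apply: ext mk mB m_min.
have [j mj] := m_surj _ b0B.
have njk : j != k by apply: contraTneq b0B => jk; rewrite -mj jk mk.
(* The side [j] is not empty: as [b] is genuine, [slack j] exceeds it in every
   order other than [j]. *)
have extj_ex : extends B j (slack j).
  by apply/extendsP => l nl; exists b => //; apply: slack_top.
pose x' := [arg max_(y > slack j | extends B j y) r j y].
have [ext_j x'_max] : extends B j x' /\ forall y, extends B j y -> r j y <= r j x'.
  by rewrite /x'; case: arg_maxnP.
have b0_minj a : a \in B -> r j b0 <= r j a by move=> aB; rewrite -mj m_min ?setU1r.
have x'B : x' \notin B.
  apply/negP => x'B; have /extendsP e := ext_j; have [l ml] := m_surj _ x'B.
  have [lj|/e[a aB]] := eqVneq l j; last by rewrite ltnNge -ml m_min ?setU1r.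
  have /e[a aB] : k != j by rewrite eq_sym.
  by rewrite ltnNge -ml lj mj b0_min.
have x'_x : x' != x.
  apply/negP => /eqP e; have /extendsP/(_ k) := ext_j.
  rewrite eq_sym => /(_ njk)[a aB]; rewrite e ltnNge -mk m_min ?setU1r //.
have prx' : primitive (x' |: B).
  apply/primitiveP => y; have [ext_y|] := boolP (extends B j y).
    have /primitiveP/(_ y)[l rl] := prB.
    have [elj|nlj] := eqVneq l j; last first.
      by have /extendsP/(_ l nlj)[a aB] := ext_y; rewrite ltnNge rl.
    by exists l => a /setU1P[->|/rl //]; rewrite elj; apply: x'_max.
  rewrite negb_forall_in => /exists_inP[l nlj].
  rewrite negb_exists_in => /forall_inP ny; exists l => a /setU1P[->|aB].
    have /extendsP/(_ l nlj)[a' a'B /ltnW] := ext_j; apply: leq_trans.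
    by rewrite leqNgt ny.
  by rewrite leqNgt ny.
exists x'; split=> // y yB pry.
have [m' [k' [m'_inj m'k m'B _ m'_min]]] := primitive_minima yB cardB pry.
have ext_k' : extends B k' y by apply: ext m'k m'B m'_min.
(* Another completion [y], least in the order [k'], must have [k' = k] or [k' = j],
   as [b0] cannot be the image of both [k] and [j] under the bijection [m']. *)
have m'b0 l : l != k' -> (forall a, a \in B -> r l b0 <= r l a) -> m' l = b0.
  move=> nl minl; apply: (@minB_uniq l) => //; first exact: m'B.
  by move=> a aB; rewrite m'_min ?setU1r.
have [k'k|nkk'] := eqVneq k k'.
  by left; apply: (@extends_uniq B k) => //; rewrite k'k.
have [k'j|njk'] := eqVneq j k'.
  by right; apply: (@extends_uniq B j) => //; rewrite k'j.
by case/eqP: njk; apply: m'_inj; rewrite !m'b0.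
Qed.

(** Scarf's lemma, in the role of Sperner's lemma. Count the pairs of a cell and a
    facet of it that carries all labels except [i0]. If no cell carried all labels,
    each cell would have two such facets or none, so the number of pairs would be
    even. But each such facet is shared by two cells, except the boundary facet
    made of the slacks other than [i0], which has one cell: the number is odd. *)
Lemma scarf (i0 : I) : exists2 A, primitive A & c @: A = [set: I].
Proof.
have [/existsP[A /andP[prA /eqP cA]]|noA] :=
  boolP [exists A, primitive A && (c @: A == [set: I])].
  by exists A.
have notfull A : primitive A -> exists i, i \notin c @: A.
  move=> prA; apply/existsP; rewrite -negb_forall; apply: contra noA => /forallP cA.
  by apply/existsP; exists A; rewrite prA; apply/eqP/setP => i; rewrite inE cA.
(* The pair [(B, x)] stands for the facet [B] of the cell [x |: B]. *)
pose P := [set p : {set U} * U | [&& p.2 \notin p.1, primitive (p.2 |: p.1),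
  c @: p.1 == [set~ i0] & #|p.1|.+1 == #|I|]].
have evenP : ~~ odd #|P|.
  apply: (@even_card_fibres _ _ (fun p => p.2 |: p.1)) => A.
  apply: even_card_paired => -[B x]; rewrite !inE /=.
  case/andP=> /and4P[xB prA /eqP cB /eqP cardB] /eqP defA.
  have c_inj : {in B &, injective c}.
    by apply/imset_injP; rewrite cB cardsC1 -cardB.
  have ncx_i0 : c x != i0.
    have [i] := notfull _ prA; rewrite imsetU1 cB !inE negb_or negbK => /andP[ni /eqP ei].
    by rewrite eq_sym -ei.
  (* The other facet of the cell omits the element [b] with the label of [x]. *)
  have [b bB cxb] : exists2 b, b \in B & c x = c b.
    by apply/imsetP; rewrite cB !inE.
  have nbx : b != x by apply: contraNneq xB => <-.
  have exch : b |: (A :\ b) = A by rewrite setD1K // -defA setU1r.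
  exists (A :\ b, b); rewrite ?inE /= ?exch ?eqxx /=.
    rewrite -defA prA andbT /=; apply/andP; split.
      rewrite -cB eqEsubset; apply/andP; split; apply/subsetP => _ /imsetP[z zB ->].
        move: zB; rewrite !inE => /andP[nzb /orP[/eqP->|zB]].
          by rewrite cxb imset_f.
        by rewrite imset_f.
      have [->|nzb] := eqVneq z b; first by rewrite -cxb imset_f // !inE eq_sym nbx eqxx.
      by rewrite imset_f // !inE nzb zB orbT.
    have := cardsD1 b (x |: B); rewrite cardsU1 xB setU1r // !add1n => -[<-].
    by rewrite cardB.
  split; first by rewrite xpair_eqE negb_and nbx orbT.
  move=> [B' y]; rewrite !inE /=.
  case/andP=> /and4P[yB' prA' /eqP cB' /eqP cardB'] /eqP defA'.
  have defB' : B' = A :\ y by rewrite -defA' setU1K.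
  have [yx|nyx] := eqVneq y x.
    by left; rewrite defB' yx -defA setU1K.
  right; suff -> : b = y by rewrite defB'.
  have yB : y \in B by have := setU11 y B'; rewrite defA' -defA !inE (negbTE nyx).
  apply: (c_inj) => //; rewrite -cxb.
  have : c y \in c @: B' by rewrite cB' -cB imset_f.
  case/imsetP=> z; rewrite defB' -defA !inE => /andP[nzy /orP[/eqP->|zB]] // cyz.
  by case/eqP: nzy; apply: c_inj.
pose B0 := slack @: [set~ i0].
have slack_inj : injective slack by apply: can_inj c_slack.
pose x0 := [arg max_(y > slack i0 | y \notin B0) r i0 y].
have [x0B0 x0_max] : x0 \notin B0 /\ forall y, y \notin B0 -> r i0 y <= r i0 x0.
  rewrite /x0; case: arg_maxnP => [|a aA amax]; last by split.
  by rewrite mem_imset // !inE eqxx.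
have p0P : (B0, x0) \in P.
  rewrite inE /= x0B0 card_imset // cardsC1 prednK; last by apply/card_gt0P; exists i0.
  rewrite eqxx andbT -imset_comp (eq_imset (g := id)) // imset_id eqxx andbT.
  apply/primitiveP => y; have [/imsetP[i _ ->]|yB0] := boolP (y \in B0).
    exists i => a _; have [->//|/slack_min/ltnW//] := eqVneq a (slack i).
  exists i0 => a /setU1P[->|]; first exact: x0_max.
  case/imsetP=> i; rewrite !inE => ni ->.
  have [/existsP[k /eqP ey]|/existsPn y_ns] := boolP [exists k, y == slack k].
    have [eki|nk] := eqVneq k i0.
      by rewrite ey eki; apply/ltnW/slack_min; rewrite (inj_eq slack_inj).
    by case/negP: yB0; rewrite ey mem_imset // !inE.
  by apply/ltnW/slack_top => //; rewrite eq_sym.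
have p0_uniq x : (B0, x) \in P -> x = x0.
  rewrite inE /= => /and4P[xB0 prx _ _]; apply: (@r_inj i0); apply/eqP.
  rewrite eqn_leq x0_max //=; have /primitiveP/(_ x0)[i ri] := prx.
  have [<-|ni] := eqVneq i i0; first by apply: ri; rewrite setU11.
  have iB0 : slack i \in B0 by rewrite mem_imset // !inE.
  have := ri _ (setU1r x iB0); rewrite leqNgt slack_min //.
  by apply: contraNneq x0B0 => ->.
suff: ~~ odd #|P :\ (B0, x0)|.
  by move=> even1; move: evenP; rewrite (cardsD1 (B0, x0)) p0P /= even1.
apply: (@even_card_fibres _ _ (fun p => p.1)) => B.
apply: even_card_paired => -[B1 x]; rewrite inE /= => /andP[/setD1P[np0 pP] /eqP eB].
move: eB np0 pP => -> {B1} np0 pP; move: (pP); rewrite inE /=.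
case/and4P=> xB prx /eqP cB /eqP cardB.
(* A facet of slacks only is determined by its labels, hence is [B0]. *)
have nBB0 : ~~ (B \subset slack @: [set: I]).
  apply: contra_neqN np0 => /subsetP sB.
  have eB : B = B0.
    apply/setP => u; apply/idP/imsetP => [uB|[i]].
      have /imsetP[i _ ui] := sB u uB; exists i => //.
      by rewrite -cB -(c_slack i) -ui imset_f.
    rewrite -cB => /imsetP[v vB ->] ->; have /imsetP[k _ vk] := sB v vB.
    by rewrite vk c_slack -vk.
  by move: pP; rewrite eB => /p0_uniq ->.
have /subsetPn[b bB b_ns] := nBB0.
have {}b_ns i : b != slack i by apply: contraNneq b_ns => ->; rewrite imset_f.
have [x' [x'B nx'x prx' only]] := primitive_exchange xB cardB prx bB b_ns.
exists (B, x').
  rewrite inE /= eqxx andbT; apply/setD1P; split.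
    by apply: contraNneq nBB0 => -[-> _]; rewrite imsetS ?subsetT.
  by rewrite inE /= x'B prx' cB cardB !eqxx.
split; first by rewrite xpair_eqE negb_and nx'x orbT.
move=> [B2 y]; rewrite inE /= => /andP[/setD1P[_ yP] /eqP eB2].
move: eB2 yP => -> {B2}; rewrite inE /= => /and4P[yB pry _ _].
by have [->|->] := only y yB pry; [left|right].
Qed.
End Scarf.

(** * Labelled grid points *)

Lemma grid_point_above (n N : nat) (v : 'I_n.+1 -> nat) : \sum_i v i <= N ->
  exists k : {ffun 'I_n.+1 -> 'I_N.+1}, \sum_i k i == N /\ forall i, v i <= k i.
Proof.
move=> vN; pose w i := v i + (i == ord0) * (N - \sum_i v i).
have sum_w : \sum_i w i = N.
  rewrite big_split /= [X in _ + X](bigD1 ord0) //= ?eqxx ?mul1n.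
  by rewrite [X in _ + (_ + X)]big1 ?addn0 ?subnKC // => i /negbTE->.
have w_lt i : w i < N.+1 by rewrite ltnS -sum_w (bigD1 i) //= leq_addr.
exists [ffun i => Ordinal (w_lt i)]; split=> [|i]; last by rewrite ffunE leq_addr.
by rewrite -[X in _ == X]sum_w; apply/eqP/eq_bigr => i _; rewrite ffunE.
Qed.

(** The points of coordinate sum [N] are the grid of mesh [1 / N] in the simplex.
    Scarf's lemma is applied with the orders given by the coordinates. In a primitive
    set, the minima [m i] of the coordinates leave no room for a further grid point,
    which forces the sum of the [(m i).+1] above [N]; hence the genuine elements
    exceed the minima by at most [n] and are close to each other. For each index
    [i], either [slack i] is in the set, and the [i]-th coordinates are small, or
    some genuine element has the label [i]. *)
Lemma sperner_grid (n N : nat) (color : ('I_n.+1 -> nat) -> 'I_n.+1) :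
  exists t : 'I_n.+1 -> nat, \sum_i t i = N /\ forall i, t i <= n \/
    exists t', [/\ \sum_j t' j = N, color t' = i &
      forall j, t' j <= t j + n /\ t j <= t' j + n].
Proof.
pose T := {k : {ffun 'I_n.+1 -> 'I_N.+1} | \sum_i k i == N}.
pose crd (t : T) i : nat := val t i.
have sum_crd (t : T) : \sum_i crd t i = N by apply/eqP/(valP t).
have crd_le t i : crd t i <= N by rewrite -ltnS /crd.
pose M := #|{: T}|.
have rk_lt (t : T) : enum_rank t < M by [].
(* Ties between grid points of equal coordinate are broken by their enumeration. *)
pose r i (u : T + 'I_n.+1) := match u with
  | inl t => (crd t i * M + enum_rank t).+1
  | inr j => if j == i then 0 else (N.+1 * M + j).+1 end.
pose c (u : T + 'I_n.+1) := match u with inl t => color (crd t) | inr j => j end.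
have rT_lt i t : crd t i * M + enum_rank t < N.+1 * M.
  rewrite mulSn addnC -ltnS -addSn -addnS -(addnS M).
  by have := rk_lt t; have := leq_mul (crd_le t i) (leqnn M); lia.
have r_inj i : injective (r i).
  move=> [t|j] [t'|j'] /=.
  - case=> /(congr1 (modn^~ M)); rewrite !modnMDl !modn_small //.
    by move=> /val_inj /enum_rank_inj ->.
  - by case: ifP => // _ [] e; have := rT_lt i t; rewrite e ltnNge leq_addr.
  - by case: ifP => // _ [] e; have := rT_lt i t'; rewrite -e ltnNge leq_addr.
  - case: ifP => [/eqP->|_]; case: ifP => [/eqP->|_] // [].
    by move/addnI/val_inj->.
have slack_min i u : u != inr i -> r i (inr i) < r i u.
  by rewrite /= eqxx; case: u => [t|j] //=; have [->|] := eqVneq j i; rewrite ?eqxx.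
have slack_top i j u : (forall k, u != inr k) -> j != i -> r j u < r j (inr i).
  case: u => [t _|k /(_ k)]; last by rewrite eqxx.
  by rewrite /= eq_sym => /negbTE ->; rewrite ltnS (leq_trans (rT_lt j t)) ?leq_addr.
have [A /primitiveP prA cA] :=
  @scarf _ _ r inr c r_inj slack_min slack_top (fun=> erefl) ord0.
have colored i : inr i \notin A -> exists2 t, inl t \in A & color (crd t) = i.
  move=> iA; have : i \in c @: A by rewrite cA.
  by case/imsetP=> -[t tA ->|j jA /= ij]; [exists t|rewrite ij jA in iA].
have [t1 t1A] : exists t, inl t \in A.
  have [|k [sk _]] := @grid_point_above n N (fun=> 0); first by rewrite big1.
  have [i ri] := prA (inl (exist _ k sk)).
  have iA : inr i \notin A by apply/negP => /ri; rewrite /= eqxx.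
  by have [t tA _] := colored i iA; exists t.
pose m i := if inr i \in A then 0 else crd [arg min_(t < t1 | inl t \in A) crd t i] i.
have m_le i t : inl t \in A -> m i <= crd t i.
  by rewrite /m; case: ifP => // _ tA; case: arg_minnP => // t' _; apply.
have sum_m : N < \sum_i (m i).+1.
  rewrite ltnNge; apply/negP => /grid_point_above[k [sk mk]].
  have [i ri] := prA (inl (exist _ k sk)).
  have iA : inr i \notin A by apply/negP => /ri; rewrite /= eqxx.
  move: (mk i); rewrite /m (negbTE iA); case: arg_minnP => // t tA _.
  have := ri _ tA; rewrite /= ltnS /crd /= => le lt.
  have := rk_lt t; rewrite /= in lt *.
  move: (val t i : nat) (k i : nat) lt le => a b lt le.
  have := leq_mul lt (leqnn M); rewrite mulSn; move: le; lia.
have le_m j t : inl t \in A -> crd t j <= m j + n.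
  move=> tA; have := sum_crd t; rewrite (bigD1 j) //= => eN.
  move: sum_m; rewrite (bigD1 j) //=.
  have : \sum_(i | i != j) (m i).+1 <= \sum_(i | i != j) crd t i + n.
    rewrite (eq_bigr (fun i => m i + 1)) => [|i _]; last by rewrite addn1.
    rewrite big_split /= leq_add ?leq_sum // => [i _|]; first exact: m_le.
    by rewrite sum1_card cardC1 card_ord.
  move: eN; move: (bigop _ _ _) (bigop _ _ _) (crd t j) (m j) => a b p q; lia.
exists (crd t1); split=> // i; have [iA|iA] := boolP (inr i \in A).
  by left; have := le_m i t1 t1A; rewrite {1}/m iA.
right; have [t tA ct] := colored i iA; exists (crd t); split=> // j.
have := le_m j t1 t1A; have := le_m j t tA; have := m_le j t tA.
by have := m_le j t1 t1A; lia.
Qed.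

(** * Covers of the standard simplex *)

From mathcomp Require Import all_classical all_reals all_analysis.
From mathcomp Require Import finmap lra.

Import Order.TTheory GRing.Theory Num.Theory.
Import numFieldNormedType.Exports.
Local Open Scope classical_set_scope.
Local Open Scope ring_scope.

Definition std_simplex (R : realType) (n : nat) : set 'rV[R]_n :=
  [set x | (forall i, 0 <= x 0 i) /\ \sum_i x 0 i = 1].

Lemma closed_le_continuous (R : realType) (T : topologicalType) (f g : T -> R) :
  continuous f -> continuous g -> closed [set x | f x <= g x].
Proof.
move=> cf cg; have -> : [set x | f x <= g x] =
    (fun x => g x - f x) @^-1` [set y | 0 <= y].
  by apply/seteqP; split=> x /=; rewrite subr_ge0.
apply: preimage_closed => [x _|]; last exact: closed_ge.
by apply: continuousB; [exact: cg|exact: cf].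
Qed.

Lemma continuous_sumr (R : realType) (V : normedModType R) (T : topologicalType)
    (n : nat) (f : 'I_n -> T -> V) :
  (forall i, continuous (f i)) -> continuous (fun x => \sum_i f i x).
Proof. by move=> cf; apply: continuous_big => //; exact: add_continuous. Qed.

Lemma std_simplex_compact (R : realType) (n : nat) : compact (@std_simplex R n).
Proof.
have crd i : continuous (fun x : 'rV[R]_n => x 0 i) by move=> x; exact: coord_continuous.
have sum_cont : continuous (fun x : 'rV[R]_n => \sum_i x 0 i) by exact: continuous_sumr.
apply: bounded_closed_compact.
- exists 1; split=> // M M1 x [x0 x1] /=; rewrite [leLHS]/Num.norm /= mx_normrE.
  apply: bigmax_le => [|[i j] _ /=]; first exact: ltW (lt_trans ltr01 M1).
  rewrite ord1 ger0_norm //; apply: le_trans (ltW M1).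
  by rewrite -x1 (bigD1 j) //= lerDl sumr_ge0.
- have -> : @std_simplex R n = (\bigcap_i [set x | 0 <= x 0 i]) `&`
      ([set x | \sum_i x 0 i <= 1] `&` [set x | 1 <= \sum_i x 0 i]).
    apply/seteqP; split=> x /= [x0].
      by move=> ->; split=> // i _; exact: x0.
    by move=> [x1 x2]; split=> [i|]; [exact: x0|apply/eqP; rewrite eq_le x1].
  apply: closedI.
    apply: closed_bigI => i _; apply: closed_le_continuous => // x.
    exact: cst_continuous.
  by apply: closedI; apply: closed_le_continuous => // x; exact: cst_continuous.
Qed.

(** Label a point by the index of a set that contains it. The nearly coincident
    points given by [sperner_grid] for finer and finer grids accumulate at a point
    [x]. Each [A i] contains [x]: either points of [A i] accumulate at [x], or the
    [i]-th coordinate of [x] vanishes. *)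
Lemma kkm_dual (R : realType) (n : nat) (A : 'I_n.+1 -> set 'rV[R]_n.+1) :
  (forall i, closed (A i)) ->
  (forall x, std_simplex x -> exists i, A i x) ->
  (forall x i, std_simplex x -> x 0 i = 0 -> A i x) ->
  exists2 x, std_simplex x & forall i, A i x.
Proof.
move=> clA covA faceA.
pose pt (N : nat) (v : 'I_n.+1 -> nat) : 'rV[R]_n.+1 := \row_i ((v i)%:R / N.+1%:R).
have ptS N v : (\sum_i v i = N.+1)%N -> std_simplex (pt N v).
  move=> sv; split=> [i|]; first by rewrite mxE divr_ge0.
  under eq_bigr do rewrite mxE.
  by rewrite -mulr_suml -natr_sum sv divff.
pose color N v : 'I_n.+1 := odflt ord0 [pick i | `[< A i (pt N v) >]].
have colorA N v : (\sum_i v i = N.+1)%N -> A (color N v) (pt N v).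
  move=> /ptS/covA[i Ai]; rewrite /color; case: pickP => [j /asboolP //|/(_ i)].
  by move/asboolP.
have [t tP] := choice (fun N => @sperner_grid n N.+1 (color N)).
pose x_ N := pt N (t N).
have x_S N : std_simplex (x_ N) by apply: ptS; exact: (tP N).1.
have [|x [xS clx]] := @std_simplex_compact R n.+1 (x_ @ \oo) _.
  by exists 0%N => // N _; apply: x_S.
exists x => // i; have [xi0|xi0] := eqVneq (x 0 i) 0; first exact: faceA.
have {}xi0 : 0 < x 0 i by rewrite lt_neqAle eq_sym xi0 xS.1.
apply: clA => B /nbhs_ballP[e /= e0 eB].
(* Half for the distance from [x] to a grid point, half for the diameter of the
   primitive set; below [x 0 i], so that the [i]-th coordinates cannot be small. *)
pose e' := Num.min e (x 0 i) / 2.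
have e'0 : 0 < e' by rewrite divr_gt0 // lt_min e0.
have [N1 _ N1P] : \forall N \near \oo, n%:R / N.+1%:R < e'.
  have e1 : 0 < e' / n.+1%:R by rewrite divr_gt0.
  have := near_infty_natSinv_lt (PosNum e1); apply: filterS => N /=.
  rewrite ltr_pdivlMr // mulrC; apply: le_lt_trans.
  by rewrite ler_wpM2r ?invr_ge0 // ler_nat.
have [||y [[k /= N1k <-] xy]] := clx [set x_ k | k in [set k | (N1 <= k)%N]] (ball x e').
- by exists N1 => // k N1k; exists k.
- exact: nbhsx_ballx.
have near_k j : `|x 0 j - x_ k 0 j| < e' by case: xy => _ /(_ 0 j).
have nk := N1P k N1k; rewrite /= in nk.
have e'e : e' + e' <= e by rewrite -splitr ge_min lexx.
have e'x : e' + e' <= x 0 i by rewrite -splitr ge_min lexx orbT.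
have [_ /(_ i)[ti|[t' [st' ct' tt']]]] := tP k.
  have : x_ k 0 i < e'.
    by rewrite mxE (le_lt_trans _ nk) // ler_wpM2r ?invr_ge0 // ler_nat.
  have := near_k i; rewrite ltr_norml => /andP[_].
  lra.
exists (pt k t'); split; first by rewrite -ct'; apply: colorA.
apply: eB; split=> // j1 j; rewrite ord1 /ball /=.
have : `|x_ k 0 j - pt k t' 0 j| < e'.
  apply: le_lt_trans nk; rewrite !mxE -mulrBl normrM [X in _ * X]ger0_norm ?invr_ge0 //.
  rewrite ler_wpM2r ?invr_ge0 //; have [t1 t2] := tt' j.
  by rewrite ler_norml lerNl opprB !lerBlDr -!natrD !ler_nat addnC t1 addnC t2.
have := near_k j; rewrite !ltr_norml; lra.
Qed.

Definition setdist (R : realType) (V : normedModType R) (A : set V) (x : V) : R :=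
  inf [set `|x - z| | z in A].

Section SetDist.
Variables (R : realType) (V : normedModType R) (A : set V).
Hypothesis A0 : A !=set0.

Let lbd x : has_lbound [set `|x - z| | z in A].
Proof. by exists 0 => _ [z _ <-]. Qed.

Let ne x : [set `|x - z| | z in A] !=set0.
Proof. by have [z Az] := A0; exists `|x - z|, z. Qed.

Lemma setdist_ge0 x : 0 <= setdist A x.
Proof. by apply: lb_le_inf => // _ [z _ <-]. Qed.

Lemma setdist_eq0 x : A x -> setdist A x = 0.
Proof.
move=> Ax; apply/eqP; rewrite eq_le setdist_ge0 andbT.
by apply: ge_inf => //; exists x => //; rewrite subrr normr0.
Qed.

Lemma setdist_gt0 x : closed A -> ~ A x -> 0 < setdist A x.
Proof.
move=> clA nAx; rewrite lt_neqAle setdist_ge0 andbT eq_sym; apply/eqP => d0.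
apply/nAx/clA => B /nbhs_ballP[e /= e0 eB].
have [_ [z Az <-] xz] := inf_adherent e0 (conj (ne x) (lbd x)).
by exists z; split=> //; apply: eB; rewrite -ball_normE /=;
  rewrite -/(setdist A x) d0 add0r in xz.
Qed.

Lemma setdist_triangle x y : setdist A x <= `|x - y| + setdist A y.
Proof.
rewrite -lerBlDl; apply: lb_le_inf => // _ [z Az <-].
rewrite lerBlDl; apply: le_trans (ler_distD y x z).
by apply: ge_inf => //; exists z.
Qed.

Lemma setdist_continuous : continuous (setdist A).
Proof.
move=> x; apply/cvgrPdist_le => e e0.
apply/nbhs_ballP; exists e => //= y; rewrite -ball_normE /= => /ltW xy.
apply: le_trans xy; rewrite ler_norml lerNl opprB !lerBlDr.
have := setdist_triangle x y; have := setdist_triangle y x.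
rewrite (distrC y x) => h1 h2.
by apply/andP.
Qed.
End SetDist.

(** The Knaster-Kuratowski-Mazurkiewicz lemma; here a face is covered by the sets
    of its vertices. If the intersection were empty, the sum [s] of the distances
    [d i] to the sets would be positive, and the sets [x 0 i * s x <= d i x] would
    satisfy the hypotheses of [kkm_dual]. At a common point [x] of these, [d i x] is
    positive as soon as [x 0 i] is, against the hypothesis on the cover. The point
    [x] is a fixed point of [d / s], so this is Brouwer's theorem in disguise. *)
Lemma kkm (R : realType) (n : nat) (A : 'I_n.+1 -> set 'rV[R]_n.+1) :
  (forall i, closed (A i)) ->
  (forall x, std_simplex x -> exists2 i, 0 < x 0 i & A i x) ->
  exists2 x, std_simplex x & forall i, A i x.
Proof.
move=> clA covA; apply: contrapT => noA.
have A0 i : A i !=set0.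
  have [|j] := covA (delta_mx 0 i).
    split=> [j|]; first by rewrite mxE ler0n.
    rewrite (bigD1 i) //= big1 => [|j /negbTE nji]; first by rewrite mxE !eqxx addr0.
    by rewrite mxE nji.
  rewrite mxE eqxx /=; have [->|] := eqVneq j i; last by rewrite ltxx.
  by exists (delta_mx 0 i).
pose d i x := setdist (A i) x.
have d_cont i : continuous (d i) by exact: setdist_continuous.
have d_ge0 i x : 0 <= d i x by exact: setdist_ge0.
pose s x := \sum_i d i x.
have s_gt0 x : std_simplex x -> 0 < s x.
  move=> xS; have [i nAi] : exists i, ~ A i x.
    by apply/existsNP => Ax; apply: noA; exists x.
  apply: lt_le_trans (setdist_gt0 (A0 i) (clA i) nAi) _.
  by rewrite /s (bigD1 i) //= lerDl sumr_ge0.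
have [i|x xS|x i xS xi|x xS dx] :=
  @kkm_dual R n (fun i => [set x : 'rV[R]_n.+1 | x 0 i * s x <= d i x]).
- apply: closed_le_continuous => //= x.
  by apply: continuousM; [exact: coord_continuous|exact: continuous_sumr].
- apply: contrapT => /forallNP /= nd.
  suff : s x < s x by rewrite ltxx.
  rewrite {1}/s -[ltRHS]mul1r -xS.2 mulr_suml; apply: ltr_sum.
    by apply/hasP; exists ord0; rewrite ?mem_index_enum.
  by move=> i _; rewrite ltNge; apply/negP/nd.
- by rewrite /= xi mul0r.
- have [i xi Ai] := covA x xS.
  have := dx i; rewrite /= /d (setdist_eq0 (A0 i) Ai) leNgt mulr_gt0 //.
  exact: s_gt0.
Qed.

(** * Convex combinations and Ky Fan's inequality *)

Lemma convex_setP (R : realType) (X : lmodType R) (A : set X) :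
  convex_set A <-> forall x y (t : R), A x -> A y -> 0 <= t <= 1 ->
    A (t *: x + (1 - t) *: y).
Proof.
split=> [cA x y t Ax Ay /andP[t0 t1]|cA x y t /set_mem Ax /set_mem Ay].
  by have /(_ x y (Itv01 t0 t1) (mem_set Ax) (mem_set Ay))/set_mem := cA.
by apply/mem_set/cA => //; rewrite ge0 le1.
Qed.

Lemma convex_sum (R : realType) (X : lmodType R) (A : set X) (n : nat)
    (t : 'I_n -> R) (y : 'I_n -> X) :
  convex_set A -> (forall i, 0 <= t i) -> \sum_i t i = 1 ->
  (forall i, 0 < t i -> A (y i)) -> A (\sum_i t i *: y i).
Proof.
move=> /convex_setP cA; elim: n t y => [|n IH] t y t0 t1 Ay.
  by move: t1; rewrite big_ord0 => /eqP; rewrite eq_sym oner_eq0.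
move: t1; rewrite !big_ord_recr /=; set s := \sum_i _ => t1.
have s0 : 0 <= s by apply: sumr_ge0.
have tn : t ord_max = 1 - s by rewrite -t1 addrAC subrr add0r.
have [sz|nsz] := eqVneq s 0.
  rewrite big1 => [|i _]; last first.
    move/eqP: sz; rewrite psumr_eq0 // => /allP/(_ i (mem_index_enum _))/eqP->.
    by rewrite scale0r.
  by rewrite tn sz subr0 scale1r add0r; apply: Ay; rewrite tn sz subr0.
have {nsz}s_gt0 : 0 < s by rewrite lt_neqAle eq_sym nsz.
pose w := widen_ord (leqnSn n) : 'I_n -> 'I_n.+1.
have As : A (\sum_i (t (w i) / s) *: y (w i)).
  apply: IH => [i||i].
  - by rewrite divr_ge0.
  - by rewrite -mulr_suml divff ?gt_eqF.
  - by rewrite pmulr_lgt0 ?invr_gt0 // => /Ay.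
have -> : \sum_(i < n) t (w i) *: y (w i) = s *: \sum_i (t (w i) / s) *: y (w i).
  rewrite scaler_sumr; apply: eq_bigr => i _.
  by rewrite scalerA mulrC divfK ?gt_eqF.
have [tz|ntz] := eqVneq (t ord_max) 0.
  have s1 : s = 1 by rewrite -t1 tz addr0.
  by rewrite s1 in As *; rewrite tz scale0r addr0 scale1r.
rewrite tn; apply: cA => //; last by rewrite s0 -subr_ge0 -tn t0.
by apply: Ay; rewrite lt_neqAle eq_sym ntz t0.
Qed.

(** Ky Fan's inequality. By compactness it suffices to treat finitely many [y].
    For these, the KKM lemma applies to the sets of [x] with [g x y >= 0]: if a
    convex combination [x] of the [y] belonged to none of the sets with positive
    weight, quasiconvexity of [g x] would give [g x x < 0]. *)
Lemma ky_fan (R : realType) (X : normedModType R) (C : set X) (g : X -> X -> R) :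
  C !=set0 -> compact C -> convex_set C ->
  (forall y, C y -> upper_semicontinuous_on C (g^~ y)) ->
  (forall x, C x -> quasiconvex C (g x)) ->
  (forall x, C x -> 0 <= g x x) ->
  exists2 x, C x & forall y, C y -> 0 <= g x y.
Proof.
move=> [x0 Cx0] cptC cvxC uscg qcvxg g_diag.
pose F y := C `&` [set x | 0 <= g x y].
(* Upper semicontinuity says that [F y] is relatively closed in [C]. *)
have closedF y : C y -> C `&` closure (F y) = F y.
  move=> Cy; apply/seteqP; split=> [x [Cx clx]|x Fx]; last first.
    by split; [exact: Fx.1|exact: subset_closure].
  split=> //=; rewrite leNgt; apply/negP => gxy.
  have [z [[Cz /= gzy]]] := clx _ (uscg y Cy x Cx 0 gxy).
  by move/(_ Cz); rewrite ltNge gzy.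
have [x xF] : \bigcap_(y in C) F y !=set0; last first.
  by exists x => [|y /xF[]//]; exact: (xF x0 Cx0).1.
have fip : finI C F; last first.
  move: cptC; rewrite compact_In0; apply; last exact: fip.
  exists (closure \o F) => y Cy /=; first exact: closed_closure.
  by rewrite closedF.
move=> D DC; have [D0|D_neq0] := eqVneq (size (finmap.enum_fset D)) 0%N.
  by exists x0 => y /= yD; have : y \in finmap.enum_fset D by []; rewrite (size0nil D0).
pose n := (size (finmap.enum_fset D)).-1.
have nE : n.+1 = size (finmap.enum_fset D) by rewrite prednK // lt0n.
pose e (i : 'I_n.+1) : X := nth 0 (finmap.enum_fset D) i.
have Ce i : C (e i).
  apply/set_mem/DC; suff : e i \in finmap.enum_fset D by []; by rewrite mem_nth // -nE.
pose p (t : 'rV[R]_n.+1) : X := \sum_i t 0 i *: e i.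
have p_cont : continuous p.
  by apply: continuous_sumr => i x; apply: continuousZl; exact: coord_continuous.
have Cp t : std_simplex t -> C (p t).
  by move=> [t0 t1]; apply: convex_sum.
have [i|t tS|t tS tF] := @kkm R n (fun i => p @^-1` closure (F (e i))).
- by apply: preimage_closed => [x _|]; [exact: p_cont|exact: closed_closure].
- apply: contrapT => noF; have Cpt := Cp t tS.
  have : (C `&` [set y | g (p t) y < 0]) (p t).
    apply: convex_sum; [|exact: tS.1|exact: tS.2|].
      apply/convex_setP => y z a [Cy gy] [Cz gz] a01; split.
        by have /convex_setP := cvxC; apply.
      by apply: le_lt_trans (qcvxg _ Cpt y z a Cy Cz a01) _; rewrite gt_max gy gz.
    move=> i ti; split=> //=; rewrite ltNge; apply/negP => gi.
    by apply: noF; exists i => //; apply: subset_closure.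
  by case=> _ /=; rewrite ltNge g_diag.
- exists (p t) => y /= yD; have {}yD : y \in finmap.enum_fset D by [].
  have iy : (index y (finmap.enum_fset D) < n.+1)%N by rewrite nE index_mem.
  have <- : e (Ordinal iy) = y by rewrite /e nth_index.
  by rewrite -closedF //; split; [exact: Cp|exact: tF].
Qed.

(** The inverse [r2v] of the coordinate map is continuous, being a linear map on row
    vectors. The minimum of [`|r2v v|] on the unit sphere is positive, so [r2v] also
    bounds the norm of the coordinates from above; thus [C] is the continuous image
    of a closed bounded set of row vectors. *)
Lemma closed_bounded_compact (R : realType) (X : normedModType R) (d : nat)
    (C : set X) (M : R) : Vector.axiom d X ->
  closed C -> (forall x, C x -> `|x| <= M) -> compact C.
Proof.
move=> [v2r v2r_lin [r2v v2rK r2vK]] clC CM.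
have r2v_lin : linear r2v.
  by move=> a u v; apply: (can_inj v2rK); rewrite v2r_lin !r2vK.
pose r2vL : {linear 'rV[R]_d -> X} :=
  HB.pack r2v (GRing.isLinear.Build R 'rV[R]_d X *:%R r2v r2v_lin).
have r2v_sum v : r2v v = \sum_i v 0 i *: r2v (delta_mx 0 i).
  rewrite [in LHS](row_sum_delta v) -[r2v]/(r2vL : _ -> _) linear_sum.
  by apply: eq_bigr => i _; rewrite linearZ.
have r2v_cont : continuous r2v.
  rewrite (_ : r2v = fun v => \sum_i v 0 i *: r2v (delta_mx 0 i)); last first.
    by apply/funext.
  by apply: continuous_sumr => i x; apply: continuousZl; exact: coord_continuous.
have N_cont : continuous (fun v => `|r2v v|).
  by move=> v; apply: (@continuous_comp _ _ _ r2v Num.norm);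
    [exact: r2v_cont|exact: norm_continuous].
have r2v0 : r2v 0 = 0 by exact: (linear0 r2vL).
have [c c0 cP] : exists2 c : R, 0 < c & forall v, c * `|v| <= `|r2v v|.
  pose S := [set v : 'rV[R]_d | `|v| = 1].
  have [[u Su]|noS] := pselect (S !=set0); last first.
    exists 1 => // v; have [->|v0] := eqVneq v 0; first by rewrite normr0 mulr0.
    case: noS; exists (`|v|^-1 *: v); rewrite /S /= normrZ normfV normr_id.
    by rewrite mulVf // normr_eq0.
  have cptS : compact S.
    apply: bounded_closed_compact.
      by exists 1; split=> // m m1 v /= ->; exact: ltW.
    apply: (@preimage_closed _ _ (fun v : 'rV[R]_d => `|v|) [set y | y = 1]) => [v _|].
      exact: norm_continuous.
    exact: closed_eq.
  have [w Sw wmin] := @EVT_min_rV R d (fun v => `|r2v v|) S (ex_intro _ u Su) cptS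
    (continuous_subspaceT N_cont).
  have {}Sw := set_mem Sw.
  exists `|r2v w| => [|v].
    rewrite normr_gt0; apply/eqP => rw0; have : w = 0 by rewrite -[w]r2vK rw0 -r2v0 r2vK.
    by move=> w0; move: Sw; rewrite /S /= w0 normr0 => /eqP; rewrite eq_sym oner_eq0.
  have [->|v0] := eqVneq v 0; first by rewrite normr0 mulr0.
  have nv : 0 < `|v| by rewrite normr_gt0.
  have Sv : S (`|v|^-1 *: v).
    by rewrite /S /= normrZ normfV normr_id mulVf // gt_eqF.
  have := wmin _ (mem_set Sv); rewrite -[r2v (_ *: _)]/(r2vL _) linearZ /= normrZ.
  by rewrite normfV normr_id mulrC ler_pdivlMr.
have -> : C = r2v @` (r2v @^-1` C).
  apply/seteqP; split=> [x Cx|_ [v Cv <-] //].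
  by exists (v2r x); rewrite /= v2rK.
apply: continuous_compact; first exact: continuous_subspaceT.
apply: bounded_closed_compact; last first.
  by apply: preimage_closed => // v _; exact: r2v_cont.
exists (M / c); split; first exact: num_real.
move=> m Mm v Cv /=; apply: le_trans (ltW Mm).
by rewrite ler_pdivlMr // mulrC; apply: le_trans (cP v) (CM _ Cv).
Qed.

(** * Coercivity and equilibria *)

(** A minimum over a ball, if attained at an interior point [u], is global: from a
    [y] with [h y < h u], semistrict quasiconvexity would make [h] smaller than
    [h u <= 0] along the whole segment from [u] to [y], whose beginning lies in
    the ball. *)
Lemma local_equilibrium_global (R : realType) (X : normedModType R) (K : set X)
    (h : X -> R) (r : R) (u : X) :
  convex_set K -> semistrictly_quasiconvex K h ->
  (forall y, K y -> `|y| <= r -> 0 <= h y) ->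
  K u -> `|u| < r -> h u <= 0 -> forall y, K y -> 0 <= h y.
Proof.
move=> /convex_setP cK [_ ssq] hr Ku ur hu y Ky; rewrite leNgt; apply/negP => hy.
have hyu : h y < h u by apply: lt_le_trans hy (hr u Ku (ltW ur)).
pose del := r - `|u|.
have del0 : 0 < del by rewrite subr_gt0.
(* Any [t] with [t * `|y| <= del] keeps the point of the segment in the ball. *)
have [t [t0 t1 tdel]] : exists t : R, [/\ 0 < t, t < 1 & t * `|y| <= del].
  have y0 := normr_ge0 y; have m0 : 0 < del + `|y| + 1 by lra.
  exists (del / (del + `|y| + 1)); split; first by rewrite divr_gt0.
    by rewrite ltr_pdivrMr // mul1r; lra.
  by rewrite mulrAC ler_pdivrMr // ler_wpM2l; lra.
have t01 : 0 < t < 1 by rewrite t0.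
have := ssq y u Ky Ku hyu t t01; apply/negP; rewrite -leNgt (le_trans hu) //.
apply: hr; first by apply: cK => //; rewrite !ltW.
apply: le_trans (ler_normD _ _) _.
rewrite !normrZ !ger0_norm ?subr_ge0 ?(ltW t0) ?(ltW t1) //.
have : (1 - t) * `|u| <= `|u| by rewrite ler_piMl // gerBl ltW.
by move: tdel; rewrite /del; lra.
Qed.

(** The sublevel set of level [f x y] contains [y], hence so does its hull. This is
    why equilibria of the regularization are equilibria of [f]. *)
Lemma fq_le (R : realType) (X : lmodType R) (K : set X) (f : X -> X -> R) x y :
  classQ K f -> K x -> K y -> fq K f x y <= f x y.
Proof.
move=> fQ Kx Ky; rewrite -lee_fin fineK; last exact: fQ.
apply: ereal_inf_lbound; exists (f x y) => //=.
apply: sub_gen_smallest; by rewrite /sublevel /extend_infty /patch /= mem_set.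
Qed.

Theorem proposition5p4 (R : realType) (X : normedModType R)
    (d : nat) (Xfindim : Vector.axiom d X)
    (K : set X) (f : X -> X -> R) :
  K !=set0 -> closed K -> convex_set K ->
  classSQ K f ->
  (forall y, K y -> upper_semicontinuous_on K (fun x => fq K f x y)) ->
  (forall x, K x -> fq K f x x = 0) ->
  coercive_C2 K (fq K f) ->
  EP f K !=set0.
Proof.
move=> [x0 Kx0] clK cvxK [fQ fSQ] usc diag C2.
suff [x Kx xP] : exists2 x, K x & forall y, K y -> 0 <= fq K f x y.
  by exists x; split=> // y Ky; apply: le_trans (xP y Ky) (fq_le fQ Kx Ky).
(* Radii for which [x0] is in the ball, and positive so that the [x_ n] on the
   boundary of the balls are nonzero. *)
pose r (n : nat) : R := `|x0| + n.+1%:R.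
pose C n := K `&` [set x | `|x| <= r n].
have solve n : exists x, C n x /\ forall y, C n y -> 0 <= fq K f x y.
  have [|||y [Ky _]|z [Kz _]|z [Kz _]|x Cx xP] := @ky_fan R X (C n) (fq K f).
  - by exists x0; split=> //=; rewrite lerDl.
  - apply: (@closed_bounded_compact R X d (C n) (r n) Xfindim) => [|x []//].
    apply: (closedI clK).
    apply: (@closed_le_continuous _ _ (Num.norm : X -> R)); first exact: norm_continuous.
    by move=> x; exact: cst_continuous.
  - apply/convex_setP => y z t [Ky yr] [Kz zr] /andP[t0 t1]; split.
      by have /convex_setP := cvxK; apply=> //; rewrite t0.
    apply: le_trans (ler_normD _ _) _; rewrite !normrZ !ger0_norm ?subr_ge0 //.
    have := ler_wpM2l t0 yr; have := zr; rewrite -subr_ge0 in t1.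
    by move=> {}zr; have := ler_wpM2l t1 zr; lra.
  - move=> z [Kz _] a za; have := usc y Ky z Kz a za; rewrite !near_withinE.
    by apply: filterS => w gw [Kw _]; apply: gw.
  - move=> y y' t [Ky _] [Ky' _] t01; exact: (fSQ z Kz).1.
  - by rewrite diag.
  - by exists x.
have [x_ x_P] := choice solve.
have [[n [u [Ku ur gu]]]|far] := pselect (exists n, exists u,
    [/\ K u, `|u| < r n & fq K f (x_ n) u <= 0]).
  have [[Kx _] xP] := x_P n; exists (x_ n) => //.
  by apply: (local_equilibrium_global cvxK (fSQ _ Kx) _ Ku ur gu) => y Ky yr; apply: xP.
(* Otherwise no solution is interior, and the solutions escape to infinity. *)
have normx n : `|x_ n| = r n.
  have [[Kx xr] _] := x_P n; apply/eqP; rewrite eq_le xr /= leNgt; apply/negP => lt.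
  by apply: far; exists n, (x_ n); rewrite diag.
have [n||n [u [Ku ur gu]]] := C2 x_.
- split; first by have [[]] := x_P n.
  by rewrite -normr_gt0 normx /r ltr_wpDl.
- rewrite (_ : (fun n => `|x_ n|) = r); last exact/funext.
  apply/cvgryPge => a; near=> n; rewrite /r.
  have : a <= n%:R by near: n; exact: nbhs_infty_ger.
  by move=> an; rewrite -natr1; have := normr_ge0 x0; lra.
- by case: far; exists n, u; rewrite -normx.
Unshelve. all: by end_near. Qed.
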